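(* Let $\mathcal{P}(\mathbb{Z}/4)$ be the category of finitely generated projective $\mathbb{Z}/4$-modules. The pair given by the category $\mathcal{P}(\mathbb{Z}/4)$ together with the identity functor (as translation functor $\Sigma$) can be endowed with a unique triangulated category structure; that is, there is exactly one collection of exact triangles $A\to B\to C\to \Sigma A=A$ in $\mathcal{P}(\mathbb{Z}/4)$ satisfying the axioms of a triangulated category with $\Sigma=\mathrm{id}$.
   Context: A triangulated category is an additive category $\mathcal{T}$ with a self-equivalence $\Sigma\colon\mathcal{T}\to\mathcal{T}$ (the translation functor) and a collection of diagrams $A\xrightarrow{f}B\xrightarrow{i}C\xrightarrow{q}\Sigma A$ (the exact, or distinguished, triangles) satisfying Puppe's axioms (closure under isomorphism, exactness of $A\xrightarrow{1}A\to 0\to\Sigma A$, every morphism fits into an exact triangle, rotation, and completion of partial morphisms to morphisms of triangles) together with Verdier's octahedral axiom. *)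

(* Defs.v *)
From HB Require Import structures.
From mathcomp Require Import all_boot all_order all_algebra.
From mathcomp Require Import boolp.

Set Implicit Arguments.
Unset Strict Implicit.
Unset Printing Implicit Defensive.

Import GRing.Theory.
Local Open Scope ring_scope.

Record additiveCat := AdditiveCat {
  Ob :> Type;
  Mor : Ob -> Ob -> zmodType;
  idm : forall A : Ob, Mor A A;
  mcomp : forall A B C : Ob, Mor B C -> Mor A B -> Mor A C;
  mcomp_idl : forall (A B : Ob) (f : Mor A B), mcomp (idm B) f = f;
  mcomp_idr : forall (A B : Ob) (f : Mor A B), mcomp f (idm A) = f;
  mcomp_assoc : forall (A B C D : Ob) (h : Mor C D) (g : Mor B C) (f : Mor A B),
    mcomp h (mcomp g f) = mcomp (mcomp h g) f;
  mcomp_addl : forall (A B C : Ob) (g g' : Mor B C) (f : Mor A B),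
    mcomp (g + g') f = mcomp g f + mcomp g' f;
  mcomp_addr : forall (A B C : Ob) (g : Mor B C) (f f' : Mor A B),
    mcomp g (f + f') = mcomp g f + mcomp g f';
  has_zero : exists Z : Ob,
    forall A : Ob, (forall f : Mor A Z, f = 0) /\ (forall f : Mor Z A, f = 0);
  has_biproducts : forall A B : Ob,
    exists (P : Ob) (i1 : Mor A P) (i2 : Mor B P) (p1 : Mor P A) (p2 : Mor P B),
    [/\ mcomp p1 i1 = idm A, mcomp p2 i2 = idm B, mcomp p1 i2 = 0, mcomp p2 i1 = 0
      & mcomp i1 p1 + mcomp i2 p2 = idm P]
}.

Arguments idm {a} A.
Arguments mcomp {a A B C} g f.

Notation "g \oc f" := (mcomp g f) (at level 50, left associativity).

(* All hom-sets are inhabited by 0, so uniqueness of arrows from and to Z is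
   just their vanishing. *)
Definition is_zero (T : additiveCat) (Z : T) : Prop :=
  forall A : T, (forall f : Mor A Z, f = 0) /\ (forall f : Mor Z A, f = 0).

Definition is_iso (T : additiveCat) (A B : T) (f : Mor A B) : Prop :=
  exists g : Mor B A, g \oc f = idm A /\ f \oc g = idm B.

Record functor (S T : additiveCat) := Functor {
  fob :> S -> T;
  fmap : forall A B : S, Mor A B -> Mor (fob A) (fob B);
  fmap_id : forall A : S, fmap (idm A) = idm (fob A);
  fmap_comp : forall (A B C : S) (g : Mor B C) (f : Mor A B),
    fmap (g \oc f) = fmap g \oc fmap f
}.

Arguments fmap {S T} F {A B} f : rename.

Definition id_functor (T : additiveCat) : functor T T :=
  @Functor T T (fun A => A) (fun _ _ f => f)
    (fun _ => erefl) (fun _ _ _ _ _ => erefl).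

Section CompFunctor.
Variables (S T U : additiveCat) (G : functor T U) (F : functor S T).

Fact comp_functor_id (A : S) : fmap G (fmap F (idm A)) = idm (G (F A)).
Proof. by rewrite !fmap_id. Qed.
Fact comp_functor_comp (A B C : S) (g : Mor B C) (f : Mor A B) :
  fmap G (fmap F (g \oc f)) = fmap G (fmap F g) \oc fmap G (fmap F f).
Proof. by rewrite !fmap_comp. Qed.

Definition comp_functor : functor S U :=
  @Functor S U (fun A => G (F A)) (fun _ _ f => fmap G (fmap F f))
    comp_functor_id comp_functor_comp.
End CompFunctor.

Definition nat_isomorphic (S T : additiveCat) (F G : functor S T) : Prop :=
  exists eta : forall A : S, Mor (F A) (G A),
    (forall A : S, is_iso (eta A)) /\
    (forall (A B : S) (f : Mor A B), eta B \oc fmap F f = fmap G f \oc eta A).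

Definition is_equivalence (S T : additiveCat) (F : functor S T) : Prop :=
  exists G : functor T S,
    nat_isomorphic (comp_functor G F) (id_functor S) /\
    nat_isomorphic (comp_functor F G) (id_functor T).

Record triangle (T : additiveCat) (Sg : functor T T) := Triangle {
  tA : T;
  tB : T;
  tC : T;
  tf : Mor tA tB;
  ti : Mor tB tC;
  tq : Mor tC (Sg tA)
}.

Arguments Triangle {T Sg tA tB tC} tf ti tq.

Definition triangle_mor (T : additiveCat) (Sg : functor T T)
    (X Y : triangle Sg)
    (a : Mor (tA X) (tA Y)) (b : Mor (tB X) (tB Y)) (c : Mor (tC X) (tC Y)) :
    Prop :=
  [/\ b \oc tf X = tf Y \oc a,
      c \oc ti X = ti Y \oc b
    & fmap Sg a \oc tq X = tq Y \oc c].

Definition triangle_iso (T : additiveCat) (Sg : functor T T)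
    (X Y : triangle Sg) : Prop :=
  exists (a : Mor (tA X) (tA Y)) (b : Mor (tB X) (tB Y))
         (c : Mor (tC X) (tC Y)),
    [/\ is_iso a, is_iso b, is_iso c & triangle_mor a b c].

(* E is the collection of exact triangles. *)
Record is_triangulated (T : additiveCat) (Sg : functor T T)
    (E : triangle Sg -> Prop) : Prop := IsTriangulated {
  translation_equiv : is_equivalence Sg;
  exact_iso : forall X Y : triangle Sg, triangle_iso X Y -> E X -> E Y;
  exact_id : forall A Z : T, is_zero Z ->
    E (Triangle (idm A) (0 : Mor A Z) (0 : Mor Z (Sg A)));
  exact_cone : forall (A B : T) (f : Mor A B),
    exists (C : T) (i : Mor B C) (q : Mor C (Sg A)), E (Triangle f i q);
  exact_rotate : forall (A B C : T) (f : Mor A B) (i : Mor B C)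
      (q : Mor C (Sg A)),
    E (Triangle f i q) <-> E (Triangle i q (- fmap Sg f));
  exact_complete : forall (X Y : triangle Sg)
      (a : Mor (tA X) (tA Y)) (b : Mor (tB X) (tB Y)),
    E X -> E Y -> b \oc tf X = tf Y \oc a ->
    exists c : Mor (tC X) (tC Y), triangle_mor a b c;
  exact_octahedral : forall (A B C D F G : T)
      (f : Mor A B) (i : Mor B D) (q : Mor D (Sg A))
      (g : Mor B C) (j : Mor C F) (r : Mor F (Sg B))
      (k : Mor C G) (s : Mor G (Sg A)),
    E (Triangle f i q) -> E (Triangle g j r) -> E (Triangle (g \oc f) k s) ->
    exists (u : Mor D G) (v : Mor G F),
      [/\ E (Triangle u v (fmap Sg i \oc r)),
          u \oc i = k \oc g, s \oc u = q,
          v \oc k = j & r \oc v = fmap Sg f \oc s]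
}.

Section LinearMaps.
Variable R : pzRingType.

Definition linHom (U V : lmodType R) : Type := {linear U -> V}.

Lemma linHom_eq (U V : lmodType R) (f g : {linear U -> V}) :
  (forall x, f x = g x) -> f = g.
Proof.
case: f g => f [[f1] [f2]] [g [[g1] [g2]]] /= /funext fg.
subst g; congr (GRing.Linear.Pack (GRing.Linear.Class _ _));
  by congr (_ _); apply: Prop_irrelevance.
Qed.

HB.instance Definition _ (U V : lmodType R) := gen_eqMixin (linHom U V).
HB.instance Definition _ (U V : lmodType R) := gen_choiceMixin (linHom U V).

Section Zmod.
Variables U V : lmodType R.

Fact linHom_add_linear (f g : {linear U -> V}) :
  linear (fun x : U => f x + g x).
Proof. by move=> a x y; rewrite !linearP scalerDr addrACA. Qed.
Fact linHom_opp_linear (f : {linear U -> V}) : linear (fun x : U => - f x).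
Proof. by move=> a x y; rewrite linearP opprD scalerN. Qed.
Fact linHom_zero_linear : linear (fun _ : U => 0 : V).
Proof. by move=> a x y; rewrite scaler0 addr0. Qed.

Definition linHom_of (f : U -> V) (lf : linear f) : {linear U -> V} :=
  HB.pack f (GRing.isLinear.Build R U V *:%R f lf).

Definition linHom_add (f g : linHom U V) : linHom U V :=
  linHom_of (linHom_add_linear f g).
Definition linHom_opp (f : linHom U V) : linHom U V :=
  linHom_of (linHom_opp_linear f).
Definition linHom_zero : linHom U V := linHom_of linHom_zero_linear.

Fact linHom_addA : associative linHom_add.
Proof. by move=> f g h; apply: linHom_eq => x /=; rewrite addrA. Qed.
Fact linHom_addC : commutative linHom_add.
Proof. by move=> f g; apply: linHom_eq => x /=; rewrite addrC. Qed.
Fact linHom_add0 : left_id linHom_zero linHom_add.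
Proof. by move=> f; apply: linHom_eq => x /=; rewrite add0r. Qed.
Fact linHom_addN : left_inverse linHom_zero linHom_opp linHom_add.
Proof. by move=> f; apply: linHom_eq => x /=; rewrite addNr. Qed.

HB.instance Definition _ := Algebra.isZmodule.Build (linHom U V)
  linHom_addA linHom_addC linHom_add0 linHom_addN.
End Zmod.

Fact lin_id_linear (U : lmodType R) : linear (fun x : U => x).
Proof. by []. Qed.
Fact lin_comp_linear (U V W : lmodType R) (g : {linear V -> W})
  (f : {linear U -> V}) : linear (fun x : U => g (f x)).
Proof. by move=> a x y; rewrite !linearP. Qed.

Definition lin_id (U : lmodType R) : linHom U U := linHom_of (@lin_id_linear U).
Definition lin_comp (U V W : lmodType R) (g : linHom V W) (f : linHom U V) :
  linHom U W := linHom_of (lin_comp_linear g f).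

Definition finitely_generated (M : lmodType R) : Prop :=
  exists (n : nat) (e : 'I_n -> M),
    forall x : M, exists c : 'I_n -> R, x = \sum_(i < n) c i *: e i.

Definition projective (P : lmodType R) : Prop :=
  forall (M N : lmodType R) (g : {linear M -> N}) (f : {linear P -> N}),
    (forall y : N, exists x : M, g x = y) ->
    exists h : {linear P -> M}, forall x : P, g (h x) = f x.

Record fgproj := FGProj {
  fgproj_mod :> lmodType R;
  fgproj_fg : finitely_generated fgproj_mod;
  fgproj_proj : projective fgproj_mod
}.

Lemma zero_fg : finitely_generated 'rV[R]_0.
Proof.
exists 0%N, (fun _ => 0) => x; exists (fun _ => 0).
by rewrite big_ord0; apply/rowP => - [].
Qed.

Lemma zero_projective : projective 'rV[R]_0.
Proof.
move=> M N g f _; exists (linHom_zero _ M) => x /=.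
have -> : x = 0 by apply/rowP => - [].
by rewrite !linear0.
Qed.

Section Prod.
Variables U V : lmodType R.

Fact inl_linear : linear (fun x : U => (x, 0 : V)).
Proof. by move=> a x y; congr (_, _); rewrite /= scaler0 addr0. Qed.
Fact inr_linear : linear (fun y : V => (0 : U, y)).
Proof. by move=> a x y; congr (_, _); rewrite /= scaler0 addr0. Qed.
Fact fst_linear : linear (fun z : U * V => z.1).
Proof. by []. Qed.
Fact snd_linear : linear (fun z : U * V => z.2).
Proof. by []. Qed.

Lemma prod_fg : finitely_generated U -> finitely_generated V ->
  finitely_generated (U * V)%type.
Proof.
move=> [m [e He]] [n [e' He']].
exists (m + n)%N, (fun k => match split k with
  | inl i => (e i, 0) | inr j => (0, e' j) end) => - [x y].
have [c ->] := He x; have [c' ->] := He' y.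
exists (fun k => match split k with inl i => c i | inr j => c' j end).
rewrite big_split_ord.
transitivity ((\sum_(i < m) c i *: e i, 0 : V)
            + (0 : U, \sum_(j < n) c' j *: e' j)).
  by congr (_, _); rewrite /= ?addr0 ?add0r.
congr (_ + _).
- rewrite -[LHS]/(linHom_of inl_linear _) linear_sum; apply: eq_bigr => i _.
  by rewrite -[lshift n i]/(unsplit (inl i)) unsplitK linearZ.
- rewrite -[LHS]/(linHom_of inr_linear _) linear_sum; apply: eq_bigr => j _.
  by rewrite -[rshift m j]/(unsplit (inr j)) unsplitK linearZ.
Qed.

Lemma prod_projective : projective U -> projective V ->
  projective (U * V)%type.
Proof.
move=> HU HV M N g f gsurj.
have [h Hh] := HU M N g (lin_comp f (linHom_of inl_linear)) gsurj.
have [k Hk] := HV M N g (lin_comp f (linHom_of inr_linear)) gsurj.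
exists (linHom_add (lin_comp h (linHom_of fst_linear))
                   (lin_comp k (linHom_of snd_linear))) => - [x y] /=.
rewrite linearD Hh Hk /= -linearD; congr (f _).
by congr (_, _); rewrite /= ?addr0 ?add0r.
Qed.
End Prod.

Definition fgproj0 : fgproj := FGProj zero_fg zero_projective.
Definition fgproj_prod (P Q : fgproj) : fgproj :=
  FGProj (prod_fg (@fgproj_fg P) (@fgproj_fg Q))
         (prod_projective (@fgproj_proj P) (@fgproj_proj Q)).

Fact lin_comp_idl (U V : lmodType R) (f : linHom U V) :
  lin_comp (lin_id V) f = f.
Proof. exact: linHom_eq. Qed.
Fact lin_comp_idr (U V : lmodType R) (f : linHom U V) :
  lin_comp f (lin_id U) = f.
Proof. exact: linHom_eq. Qed.
Fact lin_comp_assoc (U V W X : lmodType R) (h : linHom W X) (g : linHom V W)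
  (f : linHom U V) : lin_comp h (lin_comp g f) = lin_comp (lin_comp h g) f.
Proof. exact: linHom_eq. Qed.
Fact lin_compDl (U V W : lmodType R) (g g' : linHom V W) (f : linHom U V) :
  lin_comp (g + g') f = lin_comp g f + lin_comp g' f.
Proof. exact: linHom_eq. Qed.
Fact lin_compDr (U V W : lmodType R) (g : linHom V W) (f f' : linHom U V) :
  lin_comp g (f + f') = lin_comp g f + lin_comp g f'.
Proof. by apply: linHom_eq => x /=; rewrite linearD. Qed.

Fact fgproj_has_zero : exists Z : fgproj, forall P : fgproj,
  (forall f : linHom P Z, f = 0) /\ (forall f : linHom Z P, f = 0).
Proof.
exists fgproj0 => P; split=> f; apply: linHom_eq => x.
  by apply/rowP => - [].
have -> : x = 0 by apply/rowP => - [].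
by rewrite !linear0.
Qed.

Fact fgproj_has_biproducts (P Q : fgproj) :
  exists (S : fgproj) (i1 : linHom P S) (i2 : linHom Q S)
         (p1 : linHom S P) (p2 : linHom S Q),
    [/\ lin_comp p1 i1 = lin_id P, lin_comp p2 i2 = lin_id Q,
        lin_comp p1 i2 = 0, lin_comp p2 i1 = 0
      & lin_comp i1 p1 + lin_comp i2 p2 = lin_id S].
Proof.
exists (fgproj_prod P Q).
exists (linHom_of (@inl_linear P Q)), (linHom_of (@inr_linear P Q)).
exists (linHom_of (@fst_linear P Q)), (linHom_of (@snd_linear P Q)).
split; apply: linHom_eq => //= - [x y].
by congr (_, _); rewrite /= ?addr0 ?add0r.
Qed.

Definition fgproj_cat : additiveCat :=
  @AdditiveCat fgproj (fun P Q => linHom P Q) (fun P => lin_id P)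
    (fun _ _ _ g f => lin_comp g f)
    (fun _ _ => @lin_comp_idl _ _) (fun _ _ => @lin_comp_idr _ _)
    (fun _ _ _ _ => @lin_comp_assoc _ _ _ _)
    (fun _ _ _ => @lin_compDl _ _ _) (fun _ _ _ => @lin_compDr _ _ _)
    fgproj_has_zero fgproj_has_biproducts.

End LinearMaps.

(* Main.v *)
Require Import Defs.
From mathcomp Require Import all_boot all_order all_algebra.
From mathcomp Require Import boolp.

(** Over Z/4 every 3-periodic exact sequence A -f-> B -i-> C -q-> A of
    projectives has a Bockstein operator: if [f x] is divisible by 2, write
    [f x = 2 y], [i y = 2 z], [q z = 2 w]; then [x |-> w] is a well defined
    automorphism of the homology at A of the reduction mod 2.  The exact
    triangles are the exact sequences for which it is the identity.

    Uniqueness: in any triangulation the cone of [2 : R -> R] must be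
    [R -2-> R -2-> R -2-> R], and completing maps from this triangle to an
    exact triangle forces the Bockstein condition.  Conversely, a sequence with
    the Bockstein condition is isomorphic to any exact triangle on the same
    first map.

    Existence: by the Smith normal form every f is part of a triangle that
    splits, up to homotopy, as [V -2-> V -2-> V -2-> V].  Hence so are all
    sequences with the Bockstein condition, and partial maps can be completed.
    Following Neeman, the octahedral axiom is obtained by choosing completions
    whose mapping cones again satisfy the Bockstein condition.  On the cone the
    third power of the Bockstein is unipotent, and its nilpotent part
    is removed by correcting the third component of the completion by a multiple
    of 2. *)

Set Implicit Arguments.
Unset Strict Implicit.
Unset Printing Implicit Defensive.

Import GRing.Theory.
Local Open Scope ring_scope.

(** * Equalities in abelian groups killed by 4, by reflection *)

Inductive zterm :=
  ZVar of nat | ZZero | ZAdd of zterm & zterm | ZOpp of zterm | ZMul of zterm & nat.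

(** Coefficients matter only mod 4, so negation becomes multiplication by 3 and they stay natural
    numbers. *)
Fixpoint zcoef (e : zterm) (k : nat) : nat :=
  match e with
  | ZVar i => i == k
  | ZZero => 0
  | ZAdd a b => zcoef a k + zcoef b k
  | ZOpp a => 3 * zcoef a k
  | ZMul a n => n * zcoef a k
  end.

Fixpoint zeval (V : zmodType) (env : seq V) (e : zterm) : V :=
  match e with
  | ZVar i => env`_i
  | ZZero => 0
  | ZAdd a b => zeval env a + zeval env b
  | ZOpp a => - zeval env a
  | ZMul a n => zeval env a *+ n
  end.

Lemma zeval_coef (V : zmodType) (V4 : forall x : V, x *+ 4 = 0)
    (env : seq V) (e : zterm) :
  zeval env e = \sum_(k < size env) env`_k *+ zcoef e k.
Proof.
elim: e => [i||a IHa b IHb|a IHa|a IHa n] /=.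
- have [lti|gei] := ltnP i (size env).
    rewrite (bigD1 (Ordinal lti)) //= eqxx big1 ?addr0 // => j /negPf ij.
    by rewrite -val_eqE /= in ij; rewrite eq_sym ij.
  rewrite nth_default // big1 // => j _.
  by rewrite gtn_eqF // (leq_trans (ltn_ord j)).
- by rewrite big1.
- by rewrite IHa IHb -big_split; apply: eq_bigr => k _; rewrite mulrnDr.
- rewrite IHa -sumrN; apply: eq_bigr => k _; rewrite mulnC mulrnA.
  by apply/eqP; rewrite eq_sym -addr_eq0 -mulrSr V4.
- by rewrite IHa -sumrMnl; apply: eq_bigr => k _; rewrite -mulrnA mulnC.
Qed.

Definition zterm_eq (n : nat) (e1 e2 : zterm) : bool :=
  all (fun k => zcoef e1 k %% 4 == zcoef e2 k %% 4)%N (iota 0 n).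

Lemma zterm_eqP (V : zmodType) (V4 : forall x : V, x *+ 4 = 0)
    (env : seq V) (e1 e2 : zterm) :
  zterm_eq (size env) e1 e2 -> zeval env e1 = zeval env e2.
Proof.
move=> /allP e12; rewrite !zeval_coef //; apply: eq_bigr => k _.
have /e12/eqP e12k : val k \in iota 0 (size env) by rewrite mem_iota /=.
rewrite (divn_eq (zcoef e1 k) 4) (divn_eq (zcoef e2 k) 4) e12k.
by rewrite !mulrnDr ![(_ * 4)%N]mulnC !mulrnA !V4 !mul0rn.
Qed.

(** Atoms are compared by [unify], so convertible terms of different appearance are identified; the
    dummy matches run it while a term is being built. *)
Ltac zinsert x env :=
  lazymatch env with
  | nil => constr:([:: x])
  | ?y :: ?env' =>
      match constr:(Set) with
      | _ => let _ := match constr:(Set) with _ => unify x y end in env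
      | _ => let e := zinsert x env' in constr:(y :: e)
      end
  end.

Ltac zatoms t env :=
  lazymatch t with
  | @Algebra.add _ ?a ?b => let e := zatoms a env in zatoms b e
  | @Algebra.opp _ ?a => zatoms a env
  | GRing.Linear.sort (GRing.Algebra_opp__canonical__GRing_Linear _) ?a => zatoms a env
  | @Algebra.natmul _ ?a ?n => zatoms a env
  | @Algebra.zero _ => env
  | _ => zinsert t env
  end.

Ltac zposition x env :=
  lazymatch env with
  | ?y :: ?env' =>
      match constr:(Set) with
      | _ => let _ := match constr:(Set) with _ => unify x y end in constr:(O)
      | _ => let n := zposition x env' in constr:(S n)
      end
  end.

Ltac zreify t env :=
  lazymatch t with
  | @Algebra.add _ ?a ?b =>
      let a' := zreify a env in let b' := zreify b env in constr:(ZAdd a' b')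
  | @Algebra.opp _ ?a => let a' := zreify a env in constr:(ZOpp a')
  | GRing.Linear.sort (GRing.Algebra_opp__canonical__GRing_Linear _) ?a =>
      let a' := zreify a env in constr:(ZOpp a')
  | @Algebra.natmul _ ?a ?n => let a' := zreify a env in constr:(ZMul a' n)
  | @Algebra.zero _ => constr:(ZZero)
  | _ => let n := zposition t env in constr:(ZVar n)
  end.

Definition linE := (linearMn, linearD, linearN, linear0).


Lemma zfrom (V : zmodType) (l r a b : V) : l = r -> a + r = b + l -> a = b.
Proof. by move=> ->; exact: addIr. Qed.
Lemma eqD (V : zmodType) (a b c d : V) : a = b -> c = d -> a + c = b + d.
Proof. by move=> -> ->. Qed.
Lemma eqMn (V : zmodType) (a b : V) n : a = b -> a *+ n = b *+ n.
Proof. by move=> ->. Qed.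

(** * Admissible triangles and their splittings *)

Fact comb_linear (R : pzRingType) (M : lmodType R) (n : nat) (e : 'I_n -> M) :
  linear (fun c : 'rV[R]_n => \sum_i c 0 i *: e i).
Proof.
move=> a c c'; rewrite scaler_sumr -big_split; apply: eq_bigr => i _.
by rewrite !mxE scalerDl scalerA.
Qed.

(** Lifting the identity of [P] through the surjection from [R^n] given by the generators makes
    coordinates depend linearly on [x]. *)
Lemma dual_basis (R : pzRingType) (P : fgproj R) (n : nat) (e : 'I_n -> P) :
  (forall x : P, exists c : 'I_n -> R, x = \sum_(i < n) c i *: e i) ->
  exists s : {linear P -> 'rV[R]_n}, forall x, \sum_i s x 0 i *: e i = x.
Proof.
move=> eP; apply: (@fgproj_proj _ P _ _ (linHom_of (comb_linear e)) (lin_id P)).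
move=> x; have [c ->] := eP x; exists (\row_i c i) => /=.
by apply: eq_bigr => i _; rewrite mxE.
Qed.

(** Values chosen on generators are extended along the coordinates of [dual_basis], and closure
    under linear combinations keeps them in [S]. This turns pointwise diagram chases into linear
    maps. *)
Lemma linear_choice (R : pzRingType) (P : fgproj R) (M : lmodType R)
    (S : P -> M -> Prop) :
  (forall x, exists m, S x m) ->
  (forall a x x' m m', S x m -> S x' m' -> S (a *: x + x') (a *: m + m')) ->
  exists h : {linear P -> M}, forall x, S x (h x).
Proof.
move=> Stot Slin.
have S0 : S 0 0.
  have [m Sm] := Stot 0; have := Slin (-1) _ _ _ _ Sm Sm.
  by rewrite !scaleN1r !addNr.
have [n [e eP]] := fgproj_fg P.
have [m mP] := choice (fun i => Stot (e i)).
have [s sP] := dual_basis eP.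
exists (linHom_of (comb_linear m) \o s) => x /=; rewrite -[X in S X]sP.
elim/big_ind2: _ => // [x1 m1 x2 m2 S1 S2|i _].
  by have := Slin 1 _ _ _ _ S1 S2; rewrite !scale1r.
by have := Slin (s x 0 i) _ _ _ _ (mP i) S0; rewrite !addr0.
Qed.

Definition exact_at (R : pzRingType) (A B C : lmodType R)
    (f : {linear A -> B}) (g : {linear B -> C}) : Prop :=
  forall y, g y = 0 <-> exists x, f x = y.

(** Says that the Bockstein operator fixes [x]. Quantifying over the halves avoids forming the
    homology mod 2. *)
Definition bockstein (R : pzRingType) (A B C : lmodType R) (f : {linear A -> B})
    (i : {linear B -> C}) (q : {linear C -> A}) (x : A) : Prop :=
  exists y z, [/\ f x = y *+ 2, i y = z *+ 2 & q z = x *+ 2].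

(* Since [ker 2 = im 2], the condition [f x *+ 2 = 0] means that [f x] is
   divisible by 2, and the last field says that the Bockstein of [x] is [x]. *)
Record admissible (R : pzRingType) (A B C : fgproj R)
    (f : {linear A -> B}) (i : {linear B -> C}) (q : {linear C -> A}) :
    Prop := Admissible {
  admissible_fi : exact_at f i;
  admissible_iq : exact_at i q;
  admissible_qf : exact_at q f;
  admissible_bockstein : forall x, f x *+ 2 = 0 -> bockstein f i q x
}.

(* A retraction onto [V -2-> V -2-> V -2-> V] with a homotopy [h] from the
   identity to [in \o pr], that is, a decomposition into this triangle and a
   contractible one. *)
Record splitting (R : pzRingType) (A B C : fgproj R)
    (f : {linear A -> B}) (i : {linear B -> C}) (q : {linear C -> A}) := Splitting {
  spV : fgproj R;
  inA : {linear spV -> A}; inB : {linear spV -> B}; inC : {linear spV -> C};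
  prA : {linear A -> spV}; prB : {linear B -> spV}; prC : {linear C -> spV};
  hA : {linear A -> C}; hB : {linear B -> A}; hC : {linear C -> B};
  sp_if : forall x, i (f x) = 0;
  sp_qi : forall y, q (i y) = 0;
  sp_fq : forall z, f (q z) = 0;
  sp_fin : forall v, f (inA v) = inB v *+ 2;
  sp_iin : forall v, i (inB v) = inC v *+ 2;
  sp_qin : forall v, q (inC v) = inA v *+ 2;
  sp_prf : forall x, prB (f x) = prA x *+ 2;
  sp_pri : forall y, prC (i y) = prB y *+ 2;
  sp_prq : forall z, prA (q z) = prC z *+ 2;
  sp_prinA : forall v, prA (inA v) = v;
  sp_prinB : forall v, prB (inB v) = v;
  sp_prinC : forall v, prC (inC v) = v;
  sp_hA : forall x, inA (prA x) + q (hA x) + hB (f x) = x;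
  sp_hB : forall y, inB (prB y) + f (hB y) + hC (i y) = y;
  sp_hC : forall z, inC (prC z) + i (hC z) + hA (q z) = z
}.

Arguments sp_fin {R A B C f i q} s v : rename.
Arguments sp_iin {R A B C f i q} s v : rename.
Arguments sp_qin {R A B C f i q} s v : rename.
Arguments sp_prinA {R A B C f i q} s v : rename.
Arguments sp_prinB {R A B C f i q} s v : rename.
Arguments sp_prinC {R A B C f i q} s v : rename.

Section Mod4.
Variables (R : pzRingType) (R4 : forall r : R, r *+ 4 = 0).

Lemma lmod4 (M : lmodType R) (x : M) : x *+ 4 = 0.
Proof. by rewrite -[x]scale1r scalerMnl R4 scale0r. Qed.

Ltac zmod4 :=
  rewrite ?linE;
  lazymatch goal with
  | |- @eq ?T ?a ?b =>
      let env := zatoms a (@nil T) in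
      let env := zatoms b env in
      let a' := zreify a env in
      let b' := zreify b env in
      apply: (zterm_eqP (@lmod4 _) (env := env) (e1 := a') (e2 := b')); by vm_compute
  end.

(* Proves [a = b] from [H : l = r] when [a - b = l - r] holds mod 4 formally; in
   the combinations [H] below, [eqMn 3] stands for the coefficient -1. *)
Ltac zc H := apply: (zfrom H); zmod4.

Lemma pair2 (U V : fgproj R) (u : U) (v : V) :
  (u, v) *+ 2 = (u *+ 2, v *+ 2) :> fgproj_prod U V.
Proof. by []. Qed.

Lemma pairD (U V : fgproj R) (u u' : U) (v v' : V) :
  (u, v) + (u', v') = (u + u', v + v') :> fgproj_prod U V.
Proof. by []. Qed.

(** * Elements fixed by the Bockstein operator *)

Section Triangle.
Variables (A B C : lmodType R).
Variables (f : {linear A -> B}) (i : {linear B -> C}) (q : {linear C -> A}).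

(** With the next two lemmas, this lets the condition be checked modulo doubles and images under
    [q], which vanish in the homology mod 2. *)
Lemma bocksteinD x x' :
  bockstein f i q x -> bockstein f i q x' -> bockstein f i q (x + x').
Proof.
move=> [y [z [fx iy qz]]] [y' [z' [fx' iy' qz']]].
exists (y + y'), (z + z'); split.
- by zc (eqD fx fx').
- by zc (eqD iy iy').
- by zc (eqD qz qz').
Qed.

Lemma bockstein2 x : i (f x) = 0 -> bockstein f i q (x *+ 2).
Proof. by exists (f x), 0; split; [zmod4|zc H|zmod4]. Qed.

Lemma bockstein_im z : f (q z) = 0 -> bockstein f i q (q z).
Proof. by exists 0, (z *+ 2); split; [zc H|zmod4|zmod4]. Qed.
End Triangle.
Arguments bockstein2 {A B C f i q x}.
Arguments bockstein_im {A B C f i q z}.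

(** The data and equations are cyclically symmetric. The sign in the rotation axiom is handled
    separately, by [admissible_opp]. *)
Lemma splitting_rot (A B C : fgproj R) (f : {linear A -> B})
    (i : {linear B -> C}) (q : {linear C -> A}) :
  splitting f i q -> splitting i q f.
Proof.
case=> V a b c a' b' c' kA kB kC.
by move=> *; apply: (@Splitting _ _ _ _ i q f V b c a b' c' a' kB kC kA).
Defined.

Section AnnTwo.
Hypothesis R2 : forall r : R, r *+ 2 = 0 -> exists s, r = s *+ 2.

(** The property of [R] passes coordinatewise to [R^n], hence to its direct summand [P]. *)
Lemma two_exact (P : fgproj R) (x : P) : x *+ 2 = 0 -> exists y, x = y *+ 2.
Proof.
have [n [e eP]] := fgproj_fg P.
have [s sP] := dual_basis eP.
move=> x2; have s2 j : exists r, s x 0 j = r *+ 2.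
  by apply: R2; rewrite -mulmxnE -linearMn x2 linear0 mxE.
have [c cP] := choice s2.
exists (\sum_i c i *: e i); rewrite -[LHS]sP -sumrMnl.
by apply: eq_bigr => j _; rewrite scalerMnl -cP.
Qed.

(** * Rotation and change of sign *)

Section Admissible.
Variables (A B C : fgproj R) (f : {linear A -> B}) (i : {linear B -> C})
    (q : {linear C -> A}).

Lemma admissible_if : admissible f i q -> forall x, i (f x) = 0.
Proof. by move=> [fi _ _ _] x; apply/fi; exists x. Qed.
Lemma admissible_qi : admissible f i q -> forall x, q (i x) = 0.
Proof. by move=> [_ iq _ _] x; apply/iq; exists x. Qed.
Lemma admissible_fq : admissible f i q -> forall x, f (q x) = 0.
Proof. by move=> [_ _ qf _] x; apply/qf; exists x. Qed.

(** Halving along [i] and [q] leads from [y] to [x], where the hypothesis applies. It yields a fixed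
    element [y1] differing from [y] by an image under [f] and a double. *)
Lemma admissible_rot : admissible f i q -> admissible i q f.
Proof.
move=> gX; have [fi iq qf bX] := gX; split=> // y iy2.
have [z zP] := two_exact iy2.
have [|x xP] := @two_exact _ (q z).
  by have := admissible_qi gX y; rewrite zP linearMn.
have [|y1 [z1 [fx iy1 qz1]]] := bX x.
  by have := admissible_fq gX z; rewrite xP linearMn.
have [t tP] : exists t, i t = z - z1.
  by apply/iq; rewrite linearB xP qz1 subrr.
have [s sP] : exists s, f s = y - y1 - t *+ 2.
  by apply/fi; zc (eqD (eqD zP (eqMn 3 iy1)) (eqMn 2 tP)).
have -> : y = y1 + f s + t *+ 2 by rewrite sP; zmod4.
apply: bocksteinD (bocksteinD _ (bockstein_im (admissible_if gX s))) _.
- by exists z1, x; split.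
- exact: bockstein2 (admissible_qi gX t).
Qed.

(** The Bockstein condition does not see the sign, as [2 = -2] mod 4. *)
Lemma admissible_opp : admissible f i q -> admissible f i (\- q).
Proof.
move=> [fi iq qf bX]; split=> //.
- by move=> z /=; split=> [/eqP|/iq ->]; rewrite ?oppr0 // oppr_eq0 => /eqP/iq.
- move=> x /=; split=> [/qf[z <-]|[z <-]]; first by exists (- z); rewrite linearN opprK.
  by rewrite -linearN; apply/qf; exists (- z).
move=> x /bX[y [z [fx iy qz]]]; exists y, z; split=> //=.
by zc (eqMn 3 qz).
Qed.
End Admissible.

(** * Split triangles: admissibility, completion, comparison *)

Section Split.
Variables (A B C : fgproj R) (f : {linear A -> B}) (i : {linear B -> C})
    (q : {linear C -> A}).

(** The homotopy reduces exactness to that of [V -2-> V -2-> V], which is [two_exact]. *)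
Lemma splitting_exact : splitting f i q -> exact_at f i.
Proof.
move=> s y; split=> [iy|[x <-]]; last exact: sp_if s x.
have [|v vP] := @two_exact _ (prB s y).
  by rewrite -sp_pri iy linear0.
exists (inA s v + hB s y); rewrite linearD (sp_fin s) -linearMn -vP.
by rewrite -[RHS](sp_hB s) iy linear0 addr0.
Qed.
End Split.

Lemma splitting_admissible (A B C : fgproj R) (f : {linear A -> B}) (i : {linear B -> C})
    (q : {linear C -> A}) : splitting f i q -> admissible f i q.
Proof.
move=> s; split; [| | |move=> x /two_exact[y fx]].
- exact: splitting_exact s.
- exact: splitting_exact (splitting_rot s).
- exact: splitting_exact (splitting_rot (splitting_rot s)).
(* The homotopy writes [x] as an element coming from [V], where the Bockstein is visibly the
   identity, plus an image under [q] and a double. *)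
rewrite -[x](sp_hA s) fx linearMn.
apply: bocksteinD (bocksteinD _ (bockstein_im (sp_fq s _))) _.
  by exists (inB s (prA s x)), (inC s (prA s x)); rewrite (sp_fin s) (sp_iin s) (sp_qin s).
exact: bockstein2 (sp_if s _).
Qed.

(** On [V] the third component [zeta] comes from the Bockstein condition of the target; on the
    contractible part it is built from [b], a lift [lam] through [q'], and the homotopy. *)
Lemma splitting_complete (A B C A' B' C' : fgproj R)
    (f : {linear A -> B}) (i : {linear B -> C}) (q : {linear C -> A})
    (f' : {linear A' -> B'}) (i' : {linear B' -> C'}) (q' : {linear C' -> A'})
    (a : {linear A -> A'}) (b : {linear B -> B'}) :
  splitting f i q -> admissible f' i' q' -> (forall x, b (f x) = f' (a x)) ->
  exists c : {linear C -> C'},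
    (forall y, c (i y) = i' (b y)) /\ (forall z, q' (c z) = a (q z)).
Proof.
move=> s gY ab; have [fi' iq' qf' bY] := gY.
have [||zeta zetaP] := @linear_choice _ (spV s) C'
  (fun v z => i' (b (inB s v)) = z *+ 2 /\ q' z = a (inA s v) *+ 2).
- move=> v; have abv : f' (a (inA s v)) = b (inB s v) *+ 2.
    by rewrite -ab (sp_fin s) linearMn.
  have [|y [z [fx iy qz]]] := bY (a (inA s v)); first by rewrite abv; zmod4.
  have [|u uP] := @two_exact _ (b (inB s v) - y).
    by zc (eqD fx (eqMn 3 abv)).
  (* [y] and [b (inB s v)] have the same double, so they differ by [u *+ 2], and [i' u] corrects [z]
     accordingly. *)
  exists (z + i' u); split; last by rewrite linearD (admissible_qi gY) addr0.
  have -> : b (inB s v) = y + u *+ 2 by rewrite -uP; zmod4.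
  by zc iy.
- by move=> r x x' m m' [H1 H2] [H3 H4]; rewrite !linearP !mulrnDl !scalerMnr H1 H2 H3 H4.
have [||lam lamP] := @linear_choice _ A C'
  (fun x z => q' z = a (q (hA s x))).
- move=> x; apply/qf'; by rewrite -ab (sp_fq s) linear0.
- by move=> r x x' m m' H1 H2; rewrite !linearP H1 H2.
exists ((zeta \o prC s) \+ (i' \o b \o hC s) \+ (lam \o q)); split=> [y|z] /=.
  have [z1 _] := zetaP (prB s y).
  rewrite (sp_pri s) (sp_qi s) -[in RHS](sp_hB s y) !linearD ab (admissible_if gY).
  by zc (eqMn 3 z1).
have [_ z2] := zetaP (prC s z).
rewrite !linearD z2 lamP (admissible_qi gY) -[in RHS](sp_hC s z) !linearD (sp_qi s) (sp_qin s).
by zmod4.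
Qed.

Lemma five_lemma (A B C0 C : fgproj R) (f : {linear A -> B})
    (i0 : {linear B -> C0}) (q0 : {linear C0 -> A})
    (i : {linear B -> C}) (q : {linear C -> A}) (c : {linear C0 -> C}) :
  admissible f i0 q0 -> admissible f i q ->
  (forall y, c (i0 y) = i y) -> (forall z, q (c z) = q0 z) ->
  exists d : {linear C -> C0}, (forall z, d (c z) = z) /\ (forall z, c (d z) = z).
Proof.
move=> g0 g ci cq.
have c_inj z : c z = 0 -> z = 0.
  move=> cz; have /(admissible_iq g0)[y yz] : q0 z = 0 by rewrite -cq cz linear0.
  have /(admissible_fi g)[x xy] : i y = 0 by rewrite -ci yz cz.
  by rewrite -yz -xy (admissible_if g0).
have [|//|d dP] := @linear_choice _ C C0 (fun z m => c m = z).
- move=> z; have /(admissible_qf g0)[z0 z0P] : f (q z) = 0 by rewrite (admissible_fq g).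
  have /(admissible_iq g)[y yP] : q (z - c z0) = 0.
    by rewrite linearB cq z0P subrr.
  by exists (z0 + i0 y); rewrite linearD ci yP addrC subrK.
- by move=> r x x' m m' <- <-; rewrite linearP.
exists d; split=> // z; apply/eqP; rewrite -subr_eq0; apply/eqP/c_inj.
by rewrite linearB dP subrr.
Qed.

(** * Consequences of the existence of split cones *)

Section Cones.
Hypothesis cones : forall (A B : fgproj R) (f : {linear A -> B}),
  exists (C : fgproj R) (i : {linear B -> C}) (q : {linear C -> A}),
    inhabited (splitting f i q).

(** A split cone of [f] maps to the given triangle by completion; by the five lemma this map is an
    isomorphism, along which the splitting is transported. *)
Lemma admissible_splitting (A B C : fgproj R) (f : {linear A -> B})
    (i : {linear B -> C}) (q : {linear C -> A}) :
  admissible f i q -> inhabited (splitting f i q).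
Proof.
move=> g; have [C0 [i0 [q0 [s]]]] := cones f.
have [//|c [ci cq]] := splitting_complete (a := idfun) (b := idfun) s g.
have [d [dc cd]] := five_lemma (splitting_admissible s) g ci cq.
have di y : d (i y) = i0 y by rewrite -ci dc.
have q0d z : q0 (d z) = q z by rewrite -[RHS]/(q z) -[in RHS](cd z) cq.
constructor.
apply: (@Splitting _ _ _ _ f i q (spV s) (inA s) (inB s) (c \o inC s)
  (prA s) (prB s) (prC s \o d) (c \o hA s) (hB s) (hC s \o d)) => * /=.
- exact: admissible_if g _.
- exact: admissible_qi g _.
- exact: admissible_fq g _.
- exact: sp_fin s _.
- by rewrite -ci /= (sp_iin s) linearMn.
- by rewrite cq (sp_qin s).
- exact: sp_prf s _.
- by rewrite di (sp_pri s).
- by rewrite -q0d (sp_prq s).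
- exact: sp_prinA s _.
- exact: sp_prinB s _.
- by rewrite dc (sp_prinC s).
- by rewrite cq (sp_hA s).
- by rewrite di (sp_hB s).
- rewrite -q0d -ci -!linearD (sp_hC s); exact: cd.
Qed.

Lemma admissible_complete (A B C A' B' C' : fgproj R)
    (f : {linear A -> B}) (i : {linear B -> C}) (q : {linear C -> A})
    (f' : {linear A' -> B'}) (i' : {linear B' -> C'}) (q' : {linear C' -> A'})
    (a : {linear A -> A'}) (b : {linear B -> B'}) :
  admissible f i q -> admissible f' i' q' -> (forall x, b (f x) = f' (a x)) ->
  exists c : {linear C -> C'},
    (forall y, c (i y) = i' (b y)) /\ (forall z, q' (c z) = a (q z)).
Proof. by move=> /admissible_splitting[s]; exact: splitting_complete. Qed.

(* Produces the third component of a map between [V -2-> V -2-> V] and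
   [W -2-> W -2-> W] extending [al] and [be]: on lifts of the kernel of
   [al] mod 2, the sum [al + be + ga] is the obstruction to the Bockstein
   condition on the mapping cone.  The homotopy [t] of a cone of [al] is a
   generalized inverse of [al] mod 2, so [1 - t al] projects to that kernel. *)
Lemma correction (V W : fgproj R) (al be : {linear V -> W}) :
  (forall v, be v *+ 2 = al v *+ 2) ->
  exists ga : {linear V -> W}, (forall v, ga v *+ 2 = al v *+ 2) /\
    forall v, al v *+ 2 = 0 -> exists v1 u ka et,
      [/\ v = v1 + u *+ 2, al v1 = ka *+ 2, be v1 = et *+ 2
        & be v1 + ga v1 = ka *+ 2].
Proof.
move=> ab2; have [U [j [p [s]]]] := cones al.
pose t := hB s.
have [e eE] : exists e : {linear V -> V}, forall v, e v = v - t (al v).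
  by exists (idfun \- (t \o al)).
have alE v : al (e v) = inB s (prA s v) *+ 2.
  have H := congr1 al (sp_hA s v); rewrite !linearD (sp_fin s) (sp_fq s) in H.
  by rewrite eE; zc (eqMn 3 H).
have alE2 v : al (e v) *+ 2 = 0 by rewrite alE; zmod4.
have beE2 v : be (e v) *+ 2 = 0 by rewrite ab2.
(* Subtracting [be] on the projection [e] makes [be + ga] agree with [al] on the lifts [e v] of the
   kernel. *)
have [ga gaE] : exists ga : {linear V -> W},
    forall v, ga v = al v - (al (e v) *+ 2 + be (e v)).
  by exists (al \- ((al \+ al \+ be) \o e)).
exists ga; split=> v; first by rewrite gaE; zc (eqMn 3 (beE2 v)).
move=> /two_exact[w wP]; have [et etP] := two_exact (beE2 v).
exists (e v), (t w), (inB s (prA s v)), et; split=> //.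
  by rewrite eE wP; zmod4.
have ee : e (e v) = e v - e (t w) *+ 2 by rewrite [in LHS](eE v) wP; zmod4.
by rewrite gaE -alE ee; zc (eqD (eqMn 3 (alE2 v)) (beE2 (t w))).
Qed.

(** * Mapping cones and good completions *)

Fact cone_map_linear (A' B' B C : fgproj R) (f : {linear A' -> B'})
    (b : {linear B -> B'}) (i : {linear B -> C}) :
  linear (fun p : A' * B => (f p.1 + b p.2, - i p.2)).
Proof.
move=> r x y; congr pair; rewrite /= !linearP //.
by rewrite scalerDr addrACA.
Qed.

(** The first map of the mapping cone; the other two arise by rotating all arguments. *)
Definition cone_map (A' B' B C : fgproj R) (f : {linear A' -> B'})
    (b : {linear B -> B'}) (i : {linear B -> C}) :
    {linear fgproj_prod A' B -> fgproj_prod B' C} :=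
  linHom_of (cone_map_linear f b i).

Lemma cone_mapE (A' B' B C : fgproj R) (f : {linear A' -> B'})
    (b : {linear B -> B'}) (i : {linear B -> C}) x y :
  cone_map f b i (x, y) = (f x + b y, - i y).
Proof. by []. Qed.

Section MappingCone.
Variables (A B C A' B' C' : fgproj R).
Variables (f : {linear A -> B}) (i : {linear B -> C}) (q : {linear C -> A}).
Variables (f' : {linear A' -> B'}) (i' : {linear B' -> C'}) (q' : {linear C' -> A'}).
Variables (a : {linear A -> A'}) (b : {linear B -> B'}) (c : {linear C -> C'}).

Lemma cone_exact : admissible f i q -> admissible f' i' q' -> 
  (forall y, c (i y) = i' (b y)) -> (forall z, q' (c z) = a (q z)) ->
  exact_at (cone_map f' b i) (cone_map i' c q).
Proof.
move=> g g' ci cq [y' z]; split=> [|[[x' y] [<- <-]]] /=.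
  case=> yz /eqP; rewrite oppr_eq0 => /eqP/(admissible_iq g)[y yP].
  have /(admissible_fi g')[x' xP] : i' (y' + b y) = 0 by rewrite linearD -ci yP.
  exists (x', - y); congr pair; rewrite /= linearN ?opprK //.
  by rewrite xP addrK.
congr pair.
  by zc (eqD (admissible_if g' x') (eqMn 3 (ci y))).
by zc (admissible_qi g y).
Qed.

End MappingCone.

(** Every completion has an exact cone, so only the Bockstein condition is at stake. Adding to [c0]
    a map through [V] killed by 2 keeps it a completion, and makes its component on [V] equal to the
    [ga] of [correction]. *)
Lemma good_completion (A B C A' B' C' : fgproj R)
    (f : {linear A -> B}) (i : {linear B -> C}) (q : {linear C -> A})
    (f' : {linear A' -> B'}) (i' : {linear B' -> C'}) (q' : {linear C' -> A'})
    (a : {linear A -> A'}) (b : {linear B -> B'}) :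
  admissible f i q -> admissible f' i' q' -> (forall x, b (f x) = f' (a x)) ->
  exists c : {linear C -> C'},
    [/\ forall y, c (i y) = i' (b y), forall z, q' (c z) = a (q z)
      & admissible (cone_map f' b i) (cone_map i' c q) (cone_map q' a f)].
Proof.
move=> g g' ab; have [s] := admissible_splitting g; have [s'] := admissible_splitting g'.
have [c0 [c0i c0q]] := splitting_complete s g' ab.
have [al alE] : exists al : {linear spV s -> spV s'},
    forall v, al v = prA s' (a (inA s v)) by exists (prA s' \o a \o inA s).
have [be beE] : exists be : {linear spV s -> spV s'},
    forall v, be v = prB s' (b (inB s v)) by exists (prB s' \o b \o inB s).
have ab2 v : be v *+ 2 = al v *+ 2.
  by rewrite alE beE -(sp_prf s') -ab (sp_fin s) !linearMn.
have c0b2 v : prC s' (c0 (inC s v)) *+ 2 = be v *+ 2.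
  by rewrite beE -(sp_pri s') -c0i (sp_iin s) !linearMn.
have [ga [ga2 gaP]] := correction ab2.
have [c cE] : exists c : {linear C -> C'}, forall z,
    c z = c0 z + inC s' (ga (prC s z) - prC s' (c0 (inC s (prC s z)))).
  by exists (c0 \+ (inC s' \o (ga \- (prC s' \o c0 \o inC s)) \o prC s)).
have d2 v : (ga v - prC s' (c0 (inC s v))) *+ 2 = 0.
  by rewrite mulrnBl ga2 c0b2 ab2 subrr.
have ci y : c (i y) = i' (b y).
  by rewrite cE c0i (sp_pri s); zc (congr1 (inC s') (d2 (prB s y))).
have cq z : q' (c z) = a (q z).
  rewrite cE linearD c0q (sp_qin s').
  by zc (congr1 (inA s') (d2 (prC s z))).
have prc v : prC s' (c (inC s v)) = ga v.
  by rewrite cE linearD (sp_prinC s') (sp_prinC s); zmod4.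
have cone_fi := cone_exact g g' ci cq.
have cone_iq := cone_exact (admissible_rot g) (admissible_rot g')
  (fun z => esym (cq z)) (fun x => esym (ab x)).
have cone_qf := cone_exact (admissible_rot (admissible_rot g)) (admissible_rot (admissible_rot g'))
  ab (fun y => esym (ci y)).
exists c; split=> //; split=> // - [x' y] [h1 h2].
have {h1}[y' h1] := @two_exact B' _ h1.
have {h2}[z h2] : exists z, i y = z *+ 2.
  by apply: (@two_exact C); zc (eqMn 3 h2).
set v := prB s y.
have yE : y = inB s v + f (hB s y) + hC s z *+ 2.
  by rewrite -linearMn -h2 (sp_hB s).
have [v1 [u [ka [et [vE alv bev gav]]]]] : exists v1 u ka et,
    [/\ v = v1 + u *+ 2, al v1 = ka *+ 2, be v1 = et *+ 2
      & be v1 + ga v1 = ka *+ 2].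
  apply: gaP; rewrite -ab2 beE.
  have H1 := congr1 (prB s') h1.
  have H2 := congr1 (fun y => prB s' (b y)) yE.
  have H3 := sp_prf s' (x' + a (hB s y)).
  rewrite /= !linE ab in H1 H2 H3.
  by zc (eqD (eqMn 2 H1) (eqD (eqMn 2 H2) (eqMn 2 H3))).
have v2 : inB s v = inB s v1 + inB s u *+ 2 by rewrite vE; zmod4.
rewrite alE in alv; rewrite beE in bev.
(* Passing from [x'] to [x1] absorbs the summand [f (hB s y)] of [y]; [w] collects the halves of its
   double part. *)
have [w wE] : exists w, w = inB s u + hC s z by eexists.
have [x1 x1D] : exists x1, x1 = x' + a (hB s y) by eexists.
have [y1 y1P] : exists y1, f' x1 + b (inB s v1) = y1 *+ 2.
  exists (y' - b w); have H := congr1 b yE; rewrite v2 !linE ab in H; rewrite wE x1D.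
  by zc (eqD h1 (eqMn 3 H)).
have x1E := sp_hA s' x1.
(* The components are halved with the target's homotopies; the condition [gav] enters when
   [cone_map i' c q] is applied. *)
have K1 : bockstein (cone_map f' b i) (cone_map i' c q) (cone_map q' a f)
    (- hB s' (b (inB s v1)), inB s v1).
  exists (inB s' et - hC s' (c (inC s v1)), inC s v1).
  exists (inC s' ka - hA s' (a (inA s v1)), inA s v1).
  have fin := sp_fin s v1; have iin := sp_iin s v1; have qin := sp_qin s v1.
  split; rewrite cone_mapE pair2; congr pair; last 1 first.
  - by zc (eqMn 3 fin).
  - have H := sp_hB s' (b (inB s v1)); rewrite bev -ci iin !linE in H.
    by zc (eqMn 3 H).
  - by zc (eqMn 3 iin).
  - have H := sp_hC s' (c (inC s v1)); rewrite cq qin prc !linE in H.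
    have H2 := sp_iin s' et; have H3 := congr1 (inC s') gav.
    rewrite beE bev !linE in H3.
    by zc (eqD (eqMn 3 H) (eqD H2 H3)).
  - by zc (eqMn 3 qin).
  - have H := sp_hA s' (a (inA s v1)); rewrite -ab fin alv !linE in H.
    have H2 := sp_qin s' ka.
    by zc (eqD (eqMn 3 H) H2).
have K2 : bockstein (cone_map f' b i) (cone_map i' c q) (cone_map q' a f)
    (inA s' (prA s' x1), 0).
  exists (inB s' (prA s' x1), 0), (inC s' (prA s' x1), 0).
  split; rewrite cone_mapE pair2; congr pair; try zmod4.
  - by zc (sp_fin s' (prA s' x1)).
  - by zc (sp_iin s' (prA s' x1)).
  - by zc (sp_qin s' (prA s' x1)).
have K3 : bockstein (cone_map f' b i) (cone_map i' c q) (cone_map q' a f)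
    (cone_map q' a f (hA s' x1, - hB s y)).
  by apply: bockstein_im; apply/cone_qf; eexists.
have K4 : bockstein (cone_map f' b i) (cone_map i' c q) (cone_map q' a f)
    ((hB s' y1, w) *+ 2 : fgproj_prod A' B).
  by apply: bockstein2; apply/cone_fi; eexists.
(* The homotopy identities at [x1] and [y] split the element into a lift of [v1], a part from the
   target's [V], a boundary and a double. *)
have -> : (x', y) = (- hB s' (b (inB s v1)), inB s v1) + (inA s' (prA s' x1), 0)
   + cone_map q' a f (hA s' x1, - hB s y) + (hB s' y1, w) *+ 2 :> fgproj_prod A' B.
  rewrite cone_mapE pair2 !pairD; congr pair => /=.
  - have H : hB s' (f' x1) + hB s' (b (inB s v1)) = hB s' y1 *+ 2.
      by rewrite -linearD y1P linearMn.
    by zc (eqD (eqMn 3 x1E) (eqD (eqMn 3 x1D) H)).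
  - by rewrite wE; zc (eqD yE v2).
by apply: bocksteinD K4; apply: bocksteinD K3; apply: bocksteinD K2.
Qed.

(** * The octahedral axiom *)

Fact pair_linear (U V W : fgproj R) (f : {linear U -> V}) (g : {linear U -> W}) :
  linear (fun x => (f x, g x)).
Proof. by move=> a x y; rewrite !linearP. Qed.

(* The first completion gives [u] and, removing the summand [A] from its cone,
   an admissible triangle on [B -> C (+) D -> G]; completing its map to the cone
   of [g] gives [v], and the last triangle is what remains of the second cone
   after removing [B] and [C]. *)
Lemma admissible_octahedron (A B C D F G : fgproj R)
    (f : {linear A -> B}) (i : {linear B -> D}) (q : {linear D -> A})
    (g : {linear B -> C}) (j : {linear C -> F}) (r : {linear F -> B})
    (k : {linear C -> G}) (s : {linear G -> A}) :
  admissible f i q -> admissible g j r -> admissible (g \o f) k s ->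
  exists (u : {linear D -> G}) (v : {linear G -> F}),
    admissible u v (i \o r) /\
    [/\ forall y, u (i y) = k (g y), forall z, s (u z) = q z,
        forall y, v (k y) = j y & forall z, r (v z) = f (s z)].
Proof.
move=> gf gg ggf.
have [//|u [ui us cone_u]] := good_completion (a := idfun) (b := g) gf ggf.
have {}us z : s (u z) = q z := us z.
have [m1 m1E] : exists m : {linear B -> fgproj_prod C D},
    forall y, m y = (g y, - i y) by exists (linHom_of (pair_linear g (\- i))).
have [m2 m2E] : exists m : {linear fgproj_prod C D -> G},
    forall c z, m (c, z) = k c + u z by exists ((k \o fst) \+ (u \o snd)).
have [m3 m3E] : exists m : {linear G -> B}, forall w, m w = f (s w).
  by exists (f \o s).
have good_m : admissible m1 m2 m3.
  have [c_fi c_iq c_qf c_b] := cone_u; split.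
  - move=> [c z]; split=> [|[y <-]].
      rewrite m2E => kcuz.
      have cz : cone_map k u q (c, z) = 0.
        rewrite cone_mapE kcuz -us; congr pair.
        have := congr1 s kcuz; rewrite linearD (admissible_qi ggf) linear0 add0r => ->.
        by rewrite oppr0.
      have [[x y]] := (c_fi _).1 cz.
      rewrite cone_mapE => -[<- <-]; exists (f x + y); rewrite m1E !linearD /=.
      by congr pair; rewrite (admissible_if gf) oppr0 add0r.
    by rewrite m1E m2E linearN ui addrN.
  - move=> w; split=> [|[[c z] <-]].
      rewrite m3E => fsw.
      (* The coordinate [- s w] cancels [s w] through the identity of [A]. *)
      have cw : cone_map s idfun f (w, - s w) = 0.
        by rewrite cone_mapE /= addrN linearN fsw !oppr0.
      have [[c z]] := (c_iq _).1 cw.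
      by rewrite cone_mapE => -[<- _]; exists (c, z); rewrite m2E.
    rewrite m2E m3E linearD (admissible_qi ggf) us add0r; exact: admissible_fq gf z.
  - move=> y; split=> [|[w <-]].
      rewrite m1E => -[gy iy].
      have cy : cone_map (g \o f) g i (0, y) = 0.
        by rewrite cone_mapE linear0 add0r gy iy.
      have [[w x]] := (c_qf _).1 cy.
      rewrite cone_mapE => -[swx fx]; exists w; rewrite m3E -fx.
      move/eqP: swx; rewrite addr_eq0 => /eqP ->; exact: linearN.
    rewrite m3E m1E (admissible_if gf) oppr0; congr pair; exact: admissible_fq ggf w.
  move=> y; rewrite m1E => y2.
  have [|[c z] [[w x]]] := c_b (0, y).
    by rewrite cone_mapE linear0 add0r.
  rewrite !cone_mapE !pair2 linear0 add0r => -[E1 [E2 E3] [E4 E5]].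
  exists (c, z), w; rewrite m1E m2E m3E pair2; split=> //.
  by have := congr1 f E4; rewrite !linE => E6; zc (eqD E6 E5).
have [p1 p1E] : exists p : {linear fgproj_prod C D -> C}, forall x, p x = x.1.
  by exists (linHom_of (@fst_linear R C D)).
have [|v [vm rv cone_v]] := good_completion (a := idfun) (b := p1) good_m gg.
  by move=> y; rewrite p1E m1E.
have {}rv z : r (v z) = f (s z) by rewrite rv -m3E.
have {}vm x : v (m2 x) = j x.1 by rewrite vm p1E.
have vk c : v (k c) = j c by have := vm (c, 0); rewrite m2E linear0 addr0.
have vu z : v (u z) = 0 by have := vm (0, z); rewrite m2E !linear0 add0r.
exists u, v; split; last by [].
have [c_fi c_iq c_qf c_b] := cone_v; split.
- move=> w; split=> [vw|[z <-]]; last exact: vu.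
  have cw : cone_map j v m3 (0, w) = 0.
    rewrite cone_mapE vw linear0 addr0 m3E -rv vw.
    by rewrite linear0 oppr0.
  have [[x [c z]]] := (c_fi _).1 cw.
  rewrite cone_mapE m2E p1E => -[/= gxc <-]; exists (i x - z).
  rewrite linearB ui.
  by have := congr1 k gxc; rewrite !linE => E; zc E.
- move=> t; split=> [/= irt|[w <-]]; last by rewrite /= rv (admissible_if gf).
  have ct : cone_map r idfun m1 (t, - r t) = 0.
    rewrite cone_mapE addrN linearN m1E (admissible_fq gg) irt oppr0.
    by rewrite -[(0, 0)]/(0 : fgproj_prod C D) !oppr0.
  have [[c w]] := (c_iq _).1 ct.
  rewrite cone_mapE => -[<- _]; exists (k c + w).
  by rewrite linearD vk.
- move=> z; split=> [uz|[t <-]].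
    have cz : cone_map g p1 m2 (0, (0, z)) = 0.
      by rewrite cone_mapE p1E m2E uz !linear0 !addr0 oppr0.
    have [[t y]] := (c_qf _).1 cz.
    rewrite cone_mapE m1E => -[ry _ iy]; exists (- t) => /=.
    have := congr1 i ry; rewrite /= !linE => E.
    by zc (eqD (eqMn 3 E) iy).
  by rewrite /= ui (admissible_fq gg) linear0.
move=> z uz2.
have [|[c w] [[t y]]] := c_b (0, (0, z)).
  rewrite cone_mapE p1E m2E pair2 !linear0 !add0r; congr pair => /=; first by zmod4.
  by zc (eqMn 3 uz2).
rewrite !cone_mapE p1E m2E m1E !pair2 /= !linear0 !add0r.
move=> -[[c2 w2] [jcvw _] [ry _ iy]].
(* The [C] component of the half is killed by 2, hence a double, so its image under [j] can be moved
   into [t]. *)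
have [c1 c1P] := two_exact (esym c2).
exists w, (t - j c1); split.
- by zc (eqMn 3 w2).
- by have := congr1 j c1P; rewrite !linE => E; zc (eqD jcvw (eqMn 3 E)).
rewrite /= !linearB (admissible_qi gg) linear0 subr0.
by have := congr1 i ry; rewrite !linE => E; zc (eqD E (eqMn 3 iy)).
Qed.
End Cones.
End AnnTwo.
End Mod4.

(** * Cones over Z/4 *)

Section HasCone.
Variable R : pzRingType.

Definition has_cone (A B : fgproj R) (f : {linear A -> B}) : Prop :=
  exists (C : fgproj R) (i : {linear B -> C}) (q : {linear C -> A}),
    inhabited (splitting f i q).

(** The triangle is contractible, so [V = 0]; likewise for isomorphisms below, whereas
    multiplication by 2 has [V = P] and zero homotopy. *)
Lemma has_cone_zero (A B : fgproj R) (f : {linear A -> B}) :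
  (forall x, f x = 0) -> has_cone f.
Proof.
move=> f0; exists (fgproj_prod B A).
exists (linHom_of (@inl_linear R B A)), (linHom_of (@snd_linear R B A)).
constructor; unshelve refine (@Splitting R A B (fgproj_prod B A) f _ _ (fgproj0 R)
  \0 \0 \0 \0 \0 \0 (linHom_of (@inr_linear R B A)) \0 (linHom_of (@fst_linear R B A))
  _ _ _ _ _ _ _ _ _ _ _ _ _ _ _) => //=.
- by move=> x; rewrite f0.
- by move=> v; rewrite mul0rn linear0.
- by move=> v; rewrite mul0rn.
- by move=> v; rewrite mul0rn.
- by move=> v; rewrite mul0rn.
- by move=> v; rewrite mul0rn.
- by move=> v; rewrite mul0rn.
- by move=> v; apply/rowP => - [].
- by move=> v; apply/rowP => - [].
- by move=> v; apply/rowP => - [].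
- by move=> x; rewrite add0r addr0.
- by move=> x; rewrite linear0 !add0r.
- by move=> [x y]; congr pair; rewrite /= ?add0r ?addr0.
Qed.

Lemma has_cone_two (P : fgproj R) (f : {linear P -> P}) :
  (forall r : R, r *+ 4 = 0) -> (forall x, f x = x *+ 2) -> has_cone f.
Proof.
move=> R4 f2; exists P, f, f; constructor.
have ff x : f (f x) = 0 by rewrite !f2 -mulrnA lmod4.
by apply: (@Splitting _ _ _ _ f f f P idfun idfun idfun idfun idfun idfun
  \0 \0 \0) => //= x; rewrite linear0 !addr0.
Qed.

Lemma has_cone_iso (A B : fgproj R) (f : {linear A -> B}) (g : {linear B -> A}) :
  cancel f g -> cancel g f -> has_cone f.
Proof.
move=> fK gK; exists (fgproj0 R), \0, \0; constructor.
apply: (@Splitting _ _ _ _ f \0 \0 (fgproj0 R) \0 \0 \0 \0 \0 \0 \0 g \0) => //=.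
- by move=> x; rewrite linear0.
- by move=> v; rewrite mul0rn linear0.
- by move=> v; rewrite mul0rn.
- by move=> v; rewrite mul0rn.
- by move=> v; rewrite mul0rn.
- by move=> v; rewrite mul0rn.
- by move=> v; rewrite mul0rn.
- by move=> v; apply/rowP => - [].
- by move=> v; apply/rowP => - [].
- by move=> v; apply/rowP => - [].
- by move=> x; rewrite !add0r.
- by move=> x; rewrite addr0 add0r.
- by move=> z; apply/rowP => - [].
Qed.

Lemma has_cone_conj (A B A' B' : fgproj R) (f : {linear A -> B})
    (f' : {linear A' -> B'}) (a : {linear A -> A'}) (a' : {linear A' -> A})
    (b : {linear B -> B'}) (b' : {linear B' -> B}) :
  cancel a a' -> cancel a' a -> cancel b b' -> cancel b' b ->
  (forall x, f' (a x) = b (f x)) -> has_cone f -> has_cone f'.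
Proof.
move=> aK aK' bK bK' fab [C [i [q [s]]]].
have fE x : f' x = b (f (a' x)) by rewrite -fab aK'.
exists C, (i \o b'), (a \o q); constructor.
apply: (@Splitting _ _ _ _ _ _ _ (spV s) (a \o inA s) (b \o inB s) (inC s)
  (prA s \o a') (prB s \o b') (prC s) (hA s \o a') (a \o hB s \o b') (b \o hC s))
  => /= x; rewrite ?fE ?aK ?bK.
- exact: sp_if s _.
- by rewrite (sp_qi s) linear0.
- by rewrite (sp_fq s) linear0.
- by rewrite (sp_fin s) linearMn.
- exact: sp_iin s _.
- by rewrite (sp_qin s) linearMn.
- exact: sp_prf s _.
- exact: sp_pri s _.
- exact: sp_prq s _.
- exact: sp_prinA s _.
- exact: sp_prinB s _.
- exact: sp_prinC s _.
- by rewrite -!linearD (sp_hA s).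
- by rewrite -!linearD (sp_hB s).
- exact: sp_hC s _.
Qed.

Fact prod_map_linear (A B A' B' : fgproj R) (f : {linear A -> B})
    (f' : {linear A' -> B'}) :
  linear (fun x : A * A' => (f x.1, f' x.2)).
Proof. by move=> r x y; rewrite /= !linearP. Qed.

Definition prod_map (A B A' B' : fgproj R) (f : {linear A -> B})
    (f' : {linear A' -> B'}) : {linear fgproj_prod A A' -> fgproj_prod B B'} :=
  linHom_of (prod_map_linear f f').

Lemma has_cone_prod (A B A' B' : fgproj R) (f : {linear A -> B})
    (f' : {linear A' -> B'}) :
  has_cone f -> has_cone f' -> has_cone (prod_map f f').
Proof.
move=> [C [i [q [s]]]] [C' [i' [q' [s']]]].
exists (fgproj_prod C C'), (prod_map i i'), (prod_map q q'); constructor.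
apply: (@Splitting _ _ _ _ _ _ _ (fgproj_prod (spV s) (spV s'))
  (prod_map (inA s) (inA s')) (prod_map (inB s) (inB s')) (prod_map (inC s) (inC s'))
  (prod_map (prA s) (prA s')) (prod_map (prB s) (prB s')) (prod_map (prC s) (prC s'))
  (prod_map (hA s) (hA s')) (prod_map (hB s) (hB s')) (prod_map (hC s) (hC s')))
  => - [x y]; congr pair => /=.
all: match goal with h : splitting _ _ _ |- _ => solve [
  exact: (sp_if h) | exact: (sp_qi h) | exact: (sp_fq h) |
  exact: (sp_fin h) | exact: (sp_iin h) | exact: (sp_qin h) |
  exact: (sp_prf h) | exact: (sp_pri h) | exact: (sp_prq h) |
  exact: (sp_prinA h) | exact: (sp_prinB h) | exact: (sp_prinC h) |
  exact: (sp_hA h) | exact: (sp_hB h) | exact: (sp_hC h)] end.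
Qed.

Lemma rV_fg (n : nat) : finitely_generated 'rV[R]_n.
Proof.
exists n, (fun i => delta_mx 0 i) => x; exists (fun i => x 0 i).
exact: row_sum_delta.
Qed.

Lemma rV_projective (n : nat) : projective 'rV[R]_n.
Proof.
move=> M N g f gsurj.
have [m mP] := choice (fun i : 'I_n => gsurj (f (delta_mx 0 i))).
exists (linHom_of (comb_linear m)) => x /=; rewrite [in RHS](row_sum_delta x) !linear_sum.
by apply: eq_bigr => i _; rewrite !linearZ mP.
Qed.

Definition rV_fgproj (n : nat) : fgproj R := FGProj (rV_fg n) (@rV_projective n).
End HasCone.

(** * Arithmetic of Z/4 and freeness of projectives *)

Lemma Z4_four (r : 'Z_4) : r *+ 4 = 0.
Proof. by case: r => [[|[|[|[|]]]]] // ?; apply/val_inj. Qed.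

Lemma Z4_two (r : 'Z_4) : r *+ 2 = 0 -> exists s, r = s *+ 2.
Proof.
case: r => [[|[|[|[|]]]]] // lti /(congr1 val) // _.
- by exists 0; apply/val_inj.
- by exists 1; apply/val_inj.
Qed.

Lemma Z4_even_or_unit (r : 'Z_4) : (exists s, r = s *+ 2) \/ r * r = 1.
Proof.
case: r => [[|[|[|[|]]]]] // lti.
- by left; exists 0; apply/val_inj.
- by right; apply/val_inj.
- by left; exists 1; apply/val_inj.
- by right; apply/val_inj.
Qed.


Lemma Z4_unit_double (r : 'Z_4) : r * r = 1 -> r *+ 2 = 1 *+ 2.
Proof.
by case: r => [[|[|[|[|]]]]] // lti /(congr1 val) // _; apply/val_inj.
Qed.

(* With a minimal number of generators, the kernel of the presentation lies in
   2R^n, so the idempotent onto it is divisible by 2, hence zero. *)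
Lemma fgproj_free (P : fgproj 'Z_4) :
  exists (n : nat) (a : {linear P -> rV_fgproj 'Z_4 n}) (b : {linear rV_fgproj 'Z_4 n -> P}),
    cancel a b /\ cancel b a.
Proof.
have [n [e]] := fgproj_fg P; elim: n e => [|n IHn] e eP.
  exists 0%N, \0, \0; split=> x; last by apply/rowP => - [].
  by have [c ->] := eP x; rewrite big_ord0.
have [[d [j [de0 djj]]]|no_unit] :=
    pselect (exists d : 'I_n.+1 -> 'Z_4, exists j,
      \sum_k d k *: e k = 0 /\ d j * d j = 1).
  (* A relation with unit coefficient [d j], which is its own inverse, eliminates the generator
     [e j]. *)
  apply: (IHn (fun k => e (lift j k))) => x; have [c ->] := eP x.
  exists (fun k => c (lift j k) - c j * d j * d (lift j k)).
  have <- : \sum_k c k *: e k - (c j * d j) *: (\sum_k d k *: e k)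
      = \sum_k c k *: e k by rewrite de0 scaler0 subr0.
  rewrite scaler_sumr -sumrB (bigD1_ord j) //= scalerA -mulrA djj mulr1 subrr add0r.
  by apply: eq_bigr => k _; rewrite scalerBl scalerA.
have [p pE] : exists p : {linear rV_fgproj 'Z_4 n.+1 -> P},
    forall c, p c = \sum_i c 0 i *: e i by exists (linHom_of (comb_linear e)).
have [a aP] := dual_basis eP.
have aK : cancel a p by move=> x; rewrite pE aP.
exists n.+1, a, p; split=> // x.
pose d y := y - a (p y).
have pd y : p (d y) = 0 by rewrite linearB aK subrr.
have dd y : d (d y) = d y by rewrite {1}/d pd linear0 subr0.
have dD y y' : d (y + y') = d y + d y'.
  by rewrite /d 2!linearD opprD addrACA.
have d2 y : exists z, d y = z *+ 2.
  have even k : exists r, d y 0 k = r *+ 2.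
    have [//|dk1] := Z4_even_or_unit (d y 0 k); case: no_unit.
    by exists (fun l => d y 0 l), k; rewrite -pE pd.
  have [r rP] := choice even; exists (\row_k r k).
  by apply/rowP => k; rewrite rP mulmxnE mxE.
have [z zP] := d2 x; have [w wP] := d2 z.
have : d x = 0.
  rewrite -dd zP mulr2n dD wP -mulr2n -mulrnA.
  exact: (lmod4 Z4_four).
by move/eqP; rewrite subr_eq0 => /eqP.
Qed.

(** * Reduction to diagonal matrices *)

Definition mx_map (m n : nat) (M : 'M['Z_4]_(m, n)) :
    {linear rV_fgproj 'Z_4 m -> rV_fgproj 'Z_4 n} := mulmxr M.

Lemma has_cone_scale (r : 'Z_4) (P : fgproj 'Z_4) (f : {linear P -> P}) :
  (forall x, f x = r *: x) -> has_cone f.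
Proof.
move=> fr; have [[s rs]|rr] := Z4_even_or_unit r; last first.
  by apply: (@has_cone_iso _ _ _ f f) => x; rewrite !fr scalerA rr scale1r.
have [[t st]|ss] := Z4_even_or_unit s.
  by apply: has_cone_zero => x; rewrite fr rs st -mulrnA Z4_four scale0r.
apply: has_cone_two Z4_four _ => x.
by rewrite fr rs (Z4_unit_double ss) -scalerMnl scale1r.
Qed.

Fact row_mx_linear (R : pzRingType) (m n : nat) :
  linear (fun x : 'rV[R]_m * 'rV[R]_n => row_mx x.1 x.2).
Proof. by move=> a x y; rewrite scale_row_mx add_row_mx. Qed.

Fact submx_linear (R : pzRingType) (m n : nat) :
  linear (fun x : 'rV[R]_(m + n) => (lsubmx x, rsubmx x)).
Proof. by move=> a x y; rewrite !linearP. Qed.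

(** The diagonal shape of the Smith normal form is peeled off one scalar at a time; entries beyond
    the end of [d] default to 0. *)
Lemma has_cone_diag (d : seq 'Z_4) (m n : nat) :
  has_cone (mx_map (\matrix_(i < m, j < n) (d`_i *+ (i == j :> nat)))).
Proof.
elim: m n d => [|m IHm] [|n] d.
- by apply: has_cone_zero => x; apply/rowP => - [].
- by apply: has_cone_zero => x; rewrite /= [x]thinmx0 mul0mx.
- by apply: has_cone_zero => x; apply/rowP => - [].
pose a k : {linear fgproj_prod (rV_fgproj 'Z_4 1) (rV_fgproj 'Z_4 k) -> rV_fgproj 'Z_4 (1 + k)} :=
  linHom_of (@row_mx_linear _ 1 k).
pose a' k : {linear rV_fgproj 'Z_4 (1 + k) -> fgproj_prod (rV_fgproj 'Z_4 1) (rV_fgproj 'Z_4 k)} :=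
  linHom_of (@submx_linear _ 1 k).
have aK k : cancel (a k) (a' k).
  by move=> [x y]; rewrite /= row_mxKl row_mxKr.
have aK' k : cancel (a' k) (a k) by move=> x; rewrite /= hsubmxK.
apply: has_cone_conj (aK m) (aK' m) (aK n) (aK' n) _ _; last first.
  apply: has_cone_prod (has_cone_scale (r := d`_0) (f := mx_map (d`_0)%:M) _)
    (IHm n (behead d)) => x.
  by rewrite /= mul_mx_scalar.
move=> [x y] /=; set D := (\matrix_(i, j) _ in LHS).
have -> : D = block_mx (d`_0)%:M 0 0 (\matrix_(i < m, j < n)
    ((behead d)`_i *+ (i == j :> nat))) :> 'M_(1 + m, 1 + n).
  apply/matrixP => i j; rewrite !mxE.
  case: splitP => i' ->; rewrite !mxE; case: splitP => j' ->; rewrite !mxE //.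
  - by rewrite !ord1.
  - by rewrite ord1.
  - by rewrite ord1.
  - by rewrite nth_behead.
etransitivity; first exact: (@mul_row_block _ 1 1 m 1 n).
by rewrite !mulmx0 addr0 add0r.
Qed.

(** The matrix is lifted to the integers, put in Smith normal form there, and reduced mod 4, which
    keeps the transformations invertible. *)
Lemma has_cone_mx (m n : nat) (M : 'M['Z_4]_(m, n)) : has_cone (mx_map M).
Proof.
pose N : 'M[int]_(m, n) := \matrix_(i, j) (M i j : nat)%:Z.
pose red k l (K : 'M[int]_(k, l)) : 'M['Z_4]_(k, l) := map_mx intr K.
have MN : M = red _ _ N by apply/matrixP => i j; rewrite !mxE -pmulrn natr_Zp.
have [K Ku [L Lu [d _ NE]]] := int_Smith_normal_form N.
have redV k (T : 'M[int]_k) : T \in unitmx ->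
    red _ _ T *m red _ _ (invmx T) = 1%:M /\ red _ _ (invmx T) *m red _ _ T = 1%:M.
  by move=> Tu; rewrite -!map_mxM mulmxV // mulVmx // map_mx1.
have [K1 K2] := redV _ _ Ku; have [L1 L2] := redV _ _ Lu.
have mxK k (S T : 'M['Z_4]_k) : S *m T = 1%:M -> cancel (mx_map S) (mx_map T).
  by move=> ST x; rewrite /= -mulmxA ST mulmx1.
apply: has_cone_conj (mxK _ _ _ K2) (mxK _ _ _ K1) (mxK _ _ _ L1) (mxK _ _ _ L2) _
  (has_cone_diag (map intr d) m n) => x.
rewrite /= MN NE /red !map_mxM !mulmxA -[x *m _ *m _]mulmxA -/(red _ _ _).
rewrite -/(red _ _ K) K2 mulmx1; congr (_ *m _ *m _).
apply/matrixP => i j; rewrite !mxE rmorphMn /=; congr (_ *+ _).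
have [lti|gei] := ltnP i (size d); first by rewrite (nth_map 0).
by rewrite !nth_default ?size_map.
Qed.

Lemma has_cone_all (A B : fgproj 'Z_4) (f : {linear A -> B}) : has_cone f.
Proof.
have [m [a [a' [aK aK']]]] := fgproj_free A.
have [n [b [b' [bK bK']]]] := fgproj_free B.
apply: (has_cone_conj aK' aK bK' bK _ (has_cone_mx (lin1_mx (b \o f \o a')))) => x.
by rewrite /= mul_rV_lin1 /= bK.
Qed.

(** * The triangulation *)

Local Notation cat4 := (fgproj_cat 'Z_4).
Local Notation tri := (@Triangle cat4 (id_functor cat4) _ _ _).

(** The identity, used to give a morphism the type at which linearity lemmas apply. *)
Definition lmap (A B : cat4) (f : Mor A B) :
    {linear (A : fgproj 'Z_4) -> (B : fgproj 'Z_4)} := f.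

Lemma mor_eqP (A B : cat4) (f g : Mor A B) : f = g <-> forall x, lmap f x = lmap g x.
Proof. by split=> [-> //|]; exact: linHom_eq. Qed.

Lemma mcompE (A B C : cat4) (g : Mor B C) (f : Mor A B) x :
  lmap (g \oc f) x = lmap g (lmap f x).
Proof. by []. Qed.

Lemma mor_isoP (A B : cat4) (f : Mor A B) :
  is_iso f <-> exists g : Mor B A, cancel (lmap f) (lmap g) /\ cancel (lmap g) (lmap f).
Proof.
split=> -[g [gf fg]]; exists g.
  by split=> x; [move/mor_eqP: gf|move/mor_eqP: fg]; apply.
by split; apply/mor_eqP.
Qed.

Definition admissible_triangle (X : triangle (id_functor cat4)) : Prop :=
  admissible (lmap (tf X)) (lmap (ti X)) (lmap (tq X)).

Lemma exact_at_iso (A B C A' B' C' : fgproj 'Z_4)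
    (f : {linear A -> B}) (i : {linear B -> C})
    (f' : {linear A' -> B'}) (i' : {linear B' -> C'})
    (a : {linear A -> A'}) (a' : {linear A' -> A})
    (b : {linear B -> B'}) (b' : {linear B' -> B})
    (c : {linear C -> C'}) (c' : {linear C' -> C}) :
  cancel a' a -> cancel b' b -> cancel c c' ->
  (forall x, b (f x) = f' (a x)) -> (forall y, c (i y) = i' (b y)) ->
  exact_at f i -> exact_at f' i'.
Proof.
move=> aK bK cK ab bc fi y; split=> [iy|[x <-]].
  have [|x xy] := (fi (b' y)).1; first by rewrite -(cK (i _)) bc bK iy linear0.
  by exists (a x); rewrite -ab xy bK.
have if0 : i (f (a' x)) = 0 by apply/fi; exists (a' x).
by rewrite -(aK x) -ab -bc if0 linear0.
Qed.

Lemma admissible_iso (X Y : triangle (id_functor cat4)) :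
  triangle_iso X Y -> admissible_triangle X -> admissible_triangle Y.
Proof.
move=> [a [b [c [Ia Ib Ic [/mor_eqP ab /mor_eqP bc /mor_eqP ca]]]]].
have [a' [aK aK']] := (mor_isoP a).1 Ia.
have [b' [bK bK']] := (mor_isoP b).1 Ib.
have [c' [cK cK']] := (mor_isoP c).1 Ic.
case=> fi iq qf bX; split.
- exact: exact_at_iso aK' bK' cK ab bc fi.
- by apply: exact_at_iso bK' cK' aK bc _ iq => z; exact: ca.
- by apply: exact_at_iso cK' aK' bK _ ab qf => z; exact: ca.
move=> x; have {1}<- := aK' x => fx.
have [|y [z [fy iy qz]]] := bX (lmap a' x).
  rewrite -(bK (lmap (tf X) _)).
  have := ab (lmap a' x); rewrite !mcompE => ->.
  by rewrite -linearMn fx linear0.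
exists (lmap b y), (lmap c z); split.
- have := ab (lmap a' x); rewrite !mcompE aK' => <-; by rewrite fy linearMn.
- have := bc y; rewrite !mcompE => <-; by rewrite iy linearMn.
- have := ca z; rewrite !mcompE => <-.
  transitivity (lmap a (lmap (tq X) z)) => //.
  by rewrite qz linearMn aK'.
Qed.

Lemma admissible_triangulated : is_triangulated admissible_triangle.
Proof.
split.
- exists (id_functor cat4); split.
  + exists (fun A => idm A); split=> [A|A B f].
      by exists (idm A); split; exact: mcomp_idl.
    by rewrite mcomp_idl mcomp_idr.
  + exists (fun A => idm A); split=> [A|A B f].
      by exists (idm A); split; exact: mcomp_idl.
    by rewrite mcomp_idl mcomp_idr.
- exact: admissible_iso.
- move=> A Z Z0.
  have z0 (z : (Z : fgproj 'Z_4)) : z = 0 by have /mor_eqP := (Z0 Z).1 (idm Z); exact.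
  split=> /=.
  + by move=> y; split=> // _; exists y.
  + by move=> z; split=> // _; exists 0; rewrite [z]z0.
  + by move=> x; split=> [x0|[z <-]] //; exists 0; exact: esym x0.
  move=> x x2; have [y xy] := two_exact Z4_two x2.
  by exists y, 0.
- move=> A B f; have [C [i [q [s]]]] := has_cone_all (lmap f).
  exists C, i, q; exact (splitting_admissible Z4_four Z4_two s).
- move=> A B C f i q.
  have oppE (h : Mor A B) : \- lmap h = lmap (- h) :> {linear _ -> _}.
    exact: linHom_eq.
  split=> g.
    by have := admissible_opp Z4_four (admissible_rot Z4_four Z4_two g); rewrite oppE; exact.
  have := admissible_opp Z4_four g; rewrite oppE opprK => {}g.
  exact (admissible_rot Z4_four Z4_two (admissible_rot Z4_four Z4_two g)).
- move=> X Y a b gX gY /mor_eqP ab.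
  have [//|c [ci cq]] :=
    admissible_complete Z4_four Z4_two has_cone_all gX gY (a := lmap a) (b := lmap b).
  exists c; split; [exact/mor_eqP|exact/mor_eqP|].
  by apply/mor_eqP => z; exact: esym (cq z).
move=> A B C D F G f i q g j r k s gf gg ggf.
have compE (X Y Z : cat4) (h' : Mor Y Z) (h : Mor X Y) :
    lmap h' \o lmap h = lmap (h' \oc h) :> {linear _ -> _} by exact: linHom_eq.
have {}ggf : admissible (lmap g \o lmap f) (lmap k) (lmap s) by rewrite compE; exact: ggf.
have [u [v [guv [ui su vk rv]]]] :=
  admissible_octahedron Z4_four Z4_two has_cone_all gf gg ggf.
have {}guv : admissible u v (lmap (i \oc r)) by rewrite -compE; exact: guv.
by exists u, v; split=> //; apply/mor_eqP.
Qed.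

Lemma complete_triangle (E : triangle (id_functor cat4) -> Prop)
    (A B C A' B' C' : cat4) (f : Mor A B) (i : Mor B C) (q : Mor C A)
    (f' : Mor A' B') (i' : Mor B' C') (q' : Mor C' A')
    (a : Mor A A') (b : Mor B B') :
  is_triangulated E -> E (tri f i q) ->
  E (tri f' i' q') ->
  (forall x, lmap b (lmap f x) = lmap f' (lmap a x)) ->
  exists c : Mor C C', (forall y, lmap c (lmap i y) = lmap i' (lmap b y)) /\
    (forall z, lmap q' (lmap c z) = lmap a (lmap q z)).
Proof.
move=> tE EX EX' ab.
have [|c [_ ci cq]] :=
  @exact_complete _ _ _ tE (tri f i q) (tri f' i' q') a b EX EX'.
  exact/mor_eqP.
exists c; split=> [y|z]; first exact: (mor_eqP _ _).1 ci y.
exact: esym ((mor_eqP _ _).1 cq z).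
Qed.

(** * Uniqueness of the triangulation *)

Section Uniqueness.
Variable E : triangle (id_functor cat4) -> Prop.
Hypothesis tE : is_triangulated E.

Let U : cat4 := rV_fgproj 'Z_4 1.
Let e : rV_fgproj 'Z_4 1 := const_mx 1.

Lemma unitE (u : rV_fgproj 'Z_4 1) : u = u 0 0 *: e.
Proof. by apply/rowP => j; rewrite !mxE mulr1 ord1. Qed.

Fact point_linear (P : fgproj 'Z_4) (x : P) :
  linear (fun u : 'rV['Z_4]_1 => u 0 0 *: x).
Proof. by move=> r u v; rewrite !mxE scalerDl scalerA. Qed.

(** Elements of [P] are encoded as maps from the free module of rank 1, so that completing such maps
    produces elements. *)
Definition point (P : fgproj 'Z_4) (x : P) : @Mor cat4 U P :=
  linHom_of (point_linear x).

Lemma pointE (P : fgproj 'Z_4) (x : P) u : lmap (point x) u = u 0 0 *: x.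
Proof. by []. Qed.

Lemma point1 (P : fgproj 'Z_4) (x : P) : lmap (point x) e = x.
Proof. by rewrite pointE mxE scale1r. Qed.

Lemma triangulated_exact (A B C : cat4) (f : Mor A B) (i : Mor B C) (q : Mor C A) :
  E (tri f i q) -> exact_at (lmap f) (lmap i).
Proof.
move=> EX; have [Z Z0] := has_zero cat4.
have EidA := exact_id tE A Z0.
have EidU := (exact_rotate tE _ _ _).1 (exact_id tE U Z0).
have EX' := (exact_rotate tE _ _ _).1 EX.
move=> y; split=> [iy|[x <-]].
  (* Since [i y = 0], [y] gives a map from the rotated identity triangle of [U] to the rotated given
     one; its third component at [e] is the preimage. *)
  have [|c [_ cf]] := complete_triangle (a := point y) (b := 0) tE EidU EX'.
    move=> u; rewrite -[LHS]/0; apply: esym.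
    by rewrite pointE linearZ_LR iy scaler0.
  have cfe : - lmap f (lmap c e) = lmap (point y) (- e) := cf e.
  by exists (lmap c e); rewrite linearN point1 in cfe; exact: oppr_inj cfe.
have [//|c [ci _]] := complete_triangle (a := idm A) (b := f) tE EidA EX.
by rewrite -[x]/(lmap (idm A) x) -ci; exact: linear0.
Qed.

Let two : Mor U U := idm U *+ 2.

Lemma twoE u : lmap two u = u *+ 2.
Proof. by []. Qed.

(** In any cone [C] of [two], the element [i e] has a half [z], and [point z] is an isomorphism from
    [U] to [C] taking the triangle to the standard one. *)
Lemma triangulated_two : E (tri two two two).
Proof.
have [C [i [q EX]]] := exact_cone tE two.
have fi := triangulated_exact EX.
have EX1 := (exact_rotate tE _ _ _).1 EX.
have iq := triangulated_exact EX1.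
have q2 m : lmap q m *+ 2 = 0.
  apply: oppr_inj; rewrite oppr0.
  by apply/(triangulated_exact ((exact_rotate tE _ _ _).1 EX1)); exists m.
have [|z zP] := two_exact Z4_two (x := lmap i e).
  by rewrite -linearMn; apply/fi; exists e.
have e2 (x : rV_fgproj 'Z_4 1) : e <> x *+ 2.
  move=> /(congr1 (fun u : 'rV['Z_4]_1 => (u *+ 2) 0 0)).
  by rewrite -mulrnA (lmod4 Z4_four) mulmxnE !mxE => /(congr1 val).
(* [q z] is killed by 2, so it is 0 or [e *+ 2]; if it were 0, exactness would make [e] a double. *)
have qz : lmap q z = e *+ 2.
  have [w wP] := two_exact Z4_two (q2 z).
  have [[s sP]|ss] := Z4_even_or_unit (w 0 0); last first.
    by rewrite wP (unitE w) scalerMnl (Z4_unit_double ss) -scalerMnl scale1r.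
  have /iq[u uP] : lmap q z = 0.
    by rewrite wP (unitE w) sP -scalerMnl -mulrnA (lmod4 Z4_four).
  have /fi[x xP] : lmap i (e - u *+ 2) = 0.
    by rewrite linearB linearMn uP zP subrr.
  case: (e2 (x + u)); rewrite mulrnDl -twoE xP subrK //.
have pt2 u : lmap (point z) (u *+ 2) = lmap i u.
  by rewrite pointE [in RHS](unitE u) linearZ_LR zP mulmxnE -scalerMnl scalerMnr.
have qpt u : lmap q (lmap (point z) u) = u *+ 2.
  by rewrite pointE linearZ_LR qz [in RHS](unitE u) scalerMnr.
have pt_inj u : lmap (point z) u = 0 -> u = 0.
  move=> ptu; have [|w wP] := two_exact Z4_two (x := u).
    by rewrite -qpt ptu linear0.
  have /fi[x xw] : lmap i w = 0 by rewrite -pt2 -wP.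
  by rewrite wP -xw twoE -mulrnA (lmod4 Z4_four).
have [||d dP] := @linear_choice _ (C : fgproj 'Z_4) (rV_fgproj 'Z_4 1)
  (fun m u => lmap (point z) u = m).
- move=> m; have [w wP] := two_exact Z4_two (q2 m).
  have /iq[v vP] : lmap q (m - lmap (point z) w) = 0.
    by rewrite linearB qpt wP subrr.
  by exists (w + v *+ 2); rewrite linearD pt2 vP addrC subrK.
- by move=> r x x' m m' <- <-; rewrite linearP.
have dK u : d (lmap (point z) u) = u.
  by apply/eqP; rewrite -subr_eq0; apply/eqP/pt_inj; rewrite linearB dP subrr.
apply: exact_iso tE _ _ _ EX.
exists (idm U), (idm U), (d : Mor C U); split.
- by exists (idm U); rewrite mcomp_idl.
- by exists (idm U); rewrite mcomp_idl.
- by apply/mor_isoP; exists (point z).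
split; apply/mor_eqP => x; first by [].
  by rewrite !mcompE -[lmap (ti _) x]pt2; exact: dK.
by rewrite !mcompE -[x in LHS]dP; exact: qpt.
Qed.

(** If [f x = y *+ 2], then [x] and [y] define a partial map from the triangle on [two]; the value
    at [e] of a completion is the next half in the Bockstein condition. *)
Lemma exact_is_admissible X : E X -> admissible_triangle X.
Proof.
case: X => A B C f i q EX.
have EX1 := (exact_rotate tE _ _ _).1 EX.
have EX2 := (exact_rotate tE _ _ _).1 EX1.
split=> /=.
- exact: triangulated_exact EX.
- exact: triangulated_exact EX1.
- have qf := triangulated_exact EX2; move=> x; rewrite -qf /=.
  by split=> [->|/eqP]; rewrite ?oppr0 // oppr_eq0 => /eqP.
move=> x /(two_exact Z4_two)[y fx].
have [|c [ci cq]] :=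
  complete_triangle (a := point x) (b := point y) tE triangulated_two EX.
  by move=> u; rewrite !pointE twoE linearZ_LR fx mulmxnE -scalerMnl scalerMnr.
exists y, (lmap c e); split=> //.
- by rewrite -[y]point1 -ci twoE linearMn.
- by rewrite cq twoE linearMn point1.
Qed.

(** An exact triangle on the same [f] is admissible, so completion among admissible triangles and
    the five lemma make it isomorphic to [X]. *)
Lemma admissible_is_exact X : admissible_triangle X -> E X.
Proof.
case: X => A B C f i q tX.
have [C0 [i0 [q0 EX0]]] := exact_cone tE f.
have tX0 := exact_is_admissible EX0.
have [//|c [ci cq]] :=
  complete_triangle (a := idm A) (b := idm B) admissible_triangulated tX0 tX.
have [d [dc cd]] := five_lemma tX0 tX ci cq.
apply: exact_iso tE _ _ _ EX0.
exists (idm A), (idm B), c; split.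
- by exists (idm A); rewrite mcomp_idl.
- by exists (idm B); rewrite mcomp_idl.
- by apply/mor_isoP; exists d.
split; apply/mor_eqP => x; first by [].
  exact: ci.
exact: esym (cq x).
Qed.
End Uniqueness.
Theorem theorem1p1 :
  exists! E : triangle (id_functor (fgproj_cat 'Z_4)) -> Prop,
    is_triangulated E.
Proof.
exists admissible_triangle; split=> [|E tE]; first exact: admissible_triangulated.
apply/funext => X; apply/propext; split; first exact: admissible_is_exact.
exact: exact_is_admissible.
Qed.
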